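(* Let $A$ be a Banach algebra, $B$ a Banach $A$-bimodule with $\tilde Z^\ell_{A^{**}}(B^{**})=B^{**}$, and $D:A\to B^*$ a derivation. Then $D''(A^{**})B^{**}\subseteq A^*$.
   Context: For a bounded bilinear map $m:X\times Y\to Z$ define $m^*:Z^*\times X\to Y^*$, $m^{**}:Y^{**}\times Z^*\to X^*$, $m^{***}:X^{**}\times Y^{**}\to Z^{**}$ by $\langle m^*(z',x),y\rangle=\langle z',m(x,y)\rangle$, $\langle m^{**}(y'',z'),x\rangle=\langle y'',m^*(z',x)\rangle$, $\langle m^{***}(x'',y''),z'\rangle=\langle x'',m^{**}(y'',z')\rangle$. $A^{**}$ carries the first Arens product (the extension $m^{***}$ of the product) and $B^{**}$ is the Banach $A^{**}$-bimodule with actions $\pi_\ell^{***},\pi_r^{***}$, where $\pi_\ell:A\times B\to B$ and $\pi_r:B\times A\to B$ are the left and right actions; these are written by juxtaposition. $B^*$ is the dual $A$-bimodule of $B$. For $b'''\in B^{***}$, $b''\in B^{**}$, the element $b'''b''\in A^{***}$ is defined by $\langle b'''b'',a''\rangle=\langle b''',b''a''\rangle$ for $a''\in A^{**}$. $A^*$ is regarded as a subspace of $A^{***}$ canonically, and $XY=\{xy:x\in X,y\in Y\}$. $\tilde Z^\ell_{A^{**}}(B^{**})$ is the set of $b''\in B^{**}$ such that $a''\mapsto b''a''$ is continuous from $A^{**}$ with the weak$^*$ topology $\sigma(A^{**},A^* )$ to $B^{**}$ with the weak topology $\sigma(B^{**},B^{***})$. A derivation $D:A\to B^*$ is a bounded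 linear map with $D(xy)=xD(y)+D(x)y$; $D'':A^{**}\to B^{***}$ is its second adjoint. *)

(* Defs.v *)
From HB Require Import structures.
From mathcomp Require Import all_boot all_order all_algebra.
From mathcomp Require Import all_classical all_reals.
From mathcomp Require Import topology normedtype.
From mathcomp Require Import complex.

Set Implicit Arguments.
Unset Strict Implicit.
Unset Printing Implicit Defensive.

Import Order.TTheory GRing.Theory Num.Theory.
Import numFieldNormedType.Exports.

Local Open Scope classical_set_scope.
Local Open Scope ring_scope.

(* Banach spaces are taken over the real or over the complex numbers. *)
Variant scalar_kind := RealScalars | ComplexScalars.

Definition scalars (R : realType) (k : scalar_kind) : numFieldType :=
  match k with
  | RealScalars => R : numFieldType
  | ComplexScalars => R[i] : numFieldType
  end.

(* Used to show that the operator norm, a supremum of norms (which lie in the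
   nonnegative cone of the partially ordered field [scalars R k]), exists. *)
Lemma scalars_supremum (R : realType) (k : scalar_kind)
    (E : set (scalars R k)) :
  E !=set0 -> ubound E !=set0 -> E `<=` [set x | 0 <= x] ->
  supremums E !=set0.
Proof.
case: k E => /= E [x0 Ex0] [M EM] E0.
  have hE : has_sup E by split; [exists x0|exists M].
  exists (sup E); split; first exact: ub_le_sup (proj2 hE).
  by move=> y Ey; apply: ge_sup => //; exists x0.
have ReE z : E z -> z = (complex.Re z +i* 0)%C.
  by case: z => a b /E0 /=; rewrite lecE/= => /andP[/eqP -> _].
have MR y : ubound E y -> complex.Im y = 0.
  move=> /(_ _ Ex0) h; move: (ReE _ Ex0) h; case: x0 {Ex0} => a b [->].
  by case: y => c d; rewrite lecE/= => /andP[/eqP -> _].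
have hS : has_ubound (@complex.Re R @` E).
  exists (complex.Re M) => _ [z Ez <-]; have := EM _ Ez; rewrite {1}(ReE _ Ez).
  by case: (M) => c d; rewrite lecE/= => /andP[].
exists (sup (@complex.Re R @` E) +i* 0)%C; split.
  move=> z Ez; rewrite (ReE _ Ez) lecE/= eqxx/=.
  by apply: ub_le_sup => //; exists z.
move=> y Ey; have := MR _ Ey; move: Ey; case: y => c d /= Ey ->.
rewrite lecE/= eqxx/=; apply: ge_sup; first by exists (complex.Re x0), x0.
move=> _ [z Ez <-]; have := Ey _ Ez; rewrite {1}(ReE _ Ez).
by rewrite lecE/= => /andP[].
Qed.

Definition bounded_map (K : numFieldType) (V W : normedModType K)
    (f : V -> W) :=
  exists M : K, forall x, `|f x| <= M * `|x|.

Lemma bounded_map_ge0 (K : numFieldType) (V W : normedModType K)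
    (f : V -> W) : bounded_map f ->
  exists2 M : K, 0 <= M & forall x, `|f x| <= M * `|x|.
Proof.
move=> [M fM]; exists `|M| => // x; apply: le_trans (fM x) _.
have [->|x0] := eqVneq x 0; first by rewrite normr0 !mulr0.
have : 0 <= M * `|x| by rewrite (le_trans _ (fM x)).
by rewrite pmulr_lge0 ?normr_gt0// => /ger0_norm ->.
Qed.

Section dual.
Variables (R : realType) (k : scalar_kind).
Local Notation K := (scalars R k).
Variable V : normedModType K.

Definition dual_pred : {pred (V -> K^o)} :=
  fun f => `[< linear f /\ bounded_map (f : V -> K^o) >].

Record dual := Dual {
  dual_val : V -> K^o ;
  dual_valP : dual_val \in dual_pred }.

HB.instance Definition _ := [isSub for dual_val].
HB.instance Definition _ := [Choice of dual by <:].

Lemma dual_pred_submod : submod_closed dual_pred.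
Proof.
split.
  apply/asboolP; split; first by move=> a x y /=; rewrite scaler0 addr0.
  by exists 0 => x /=; rewrite normr0 mul0r.
move=> a f g /asboolP[lf [M fM]] /asboolP[lg [N gN]]; apply/asboolP; split.
  move=> b x y; have E z : (a *: f + g) z = a *: f z + g z by [].
  by rewrite !E lf lg !scalerDr !scalerA mulrC addrACA.
exists (`|a| * M + N) => x.
rewrite (le_trans (ler_normD _ _))// mulrDl lerD//.
by rewrite normrZ -mulrA ler_wpM2l.
Qed.

HB.instance Definition _ :=
  GRing.isSubmodClosed.Build K (V -> K^o) dual_pred dual_pred_submod.
HB.instance Definition _ := [SubChoice_isSubLmodule of dual by <:].

Definition dual_fun (f : dual) : V -> K^o := dual_val f.
Coercion dual_fun : dual >-> Funclass.

Lemma dual_linear (f : dual) : linear (dual_fun f).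
Proof. by have /asboolP[] := dual_valP f. Qed.

HB.instance Definition _ (f : dual) :=
  GRing.isLinear.Build K V K^o *:%R (dual_fun f) (dual_linear f).

Lemma dual_bounded (f : dual) : bounded_map (dual_fun f).
Proof. by have /asboolP[] := dual_valP f. Qed.

Lemma dualP (f g : dual) : (forall x, f x = g x) -> f = g.
Proof. by move=> fg; apply: val_inj; apply/funext. Qed.

Lemma dualDE (f g : dual) x : (f + g) x = f x + g x. Proof. by []. Qed.
Lemma dualZE a (f : dual) x : (a *: f) x = a *: f x. Proof. by []. Qed.

Definition dual_norm (f : dual) : K :=
  supremum 0 [set `|f x| | x in [set x : V | `|x| <= 1]].

Let dual_norm_supremums (f : dual) :
  supremums [set `|f x| | x in [set x : V | `|x| <= 1]] !=set0.
Proof.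
apply: scalars_supremum.
- by exists `|f 0|, 0 => //=; rewrite normr0.
- have [M M0 fM] := bounded_map_ge0 (dual_bounded f).
  exists M => _ [x /= x1 <-]; apply: le_trans (fM x) _.
  by rewrite -[leRHS]mulr1 ler_wpM2l.
- by move=> _ [x _ <-] /=.
Qed.

Let dual_norm_sup (f : dual) : supremums
  [set `|f x| | x in [set x : V | `|x| <= 1]] (dual_norm f).
Proof.
rewrite /dual_norm /supremum ifF; last first.
  by apply/negbTE/set0P; exists `|f 0|, 0 => //=; rewrite normr0.
by have [y ys] := dual_norm_supremums f; case: xgetP => // /(_ y).
Qed.

Let dual_norm_ge0 f : 0 <= dual_norm f.
Proof.
have [ub _] := dual_norm_sup f; apply: le_trans (normr_ge0 (f 0)) (ub _ _).
by exists 0 => //=; rewrite normr0.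
Qed.

Let dual_norm_le (f : dual) x : `|f x| <= dual_norm f * `|x|.
Proof.
have [->|x0] := eqVneq x 0; first by rewrite linear0 !normr0 mulr0.
have nx : 0 < `|x| by rewrite normr_gt0.
rewrite -ler_pdivrMr//; have [+ _] := dual_norm_sup f; apply.
exists (`|x|^-1 *: x) => /=.
  by rewrite normrZ normfV normr_id mulVf ?gt_eqF.
by rewrite linearZ normrZ normfV normr_id mulrC.
Qed.

Let dual_norm_lub (f : dual) (M : K) : 0 <= M ->
  (forall x, `|f x| <= M * `|x|) -> dual_norm f <= M.
Proof.
move=> M0 fM; have [_] := dual_norm_sup f; apply => _ [x /= x1 <-].
by rewrite (le_trans (fM x))// -[leRHS]mulr1 ler_wpM2l.
Qed.

Let dual_normD (f g : dual) : dual_norm (f + g) <= dual_norm f + dual_norm g.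
Proof.
apply: dual_norm_lub => [|x]; first by rewrite addr_ge0.
by rewrite dualDE (le_trans (ler_normD _ _))// mulrDl lerD.
Qed.

Let dual_normZ_le a (f : dual) : dual_norm (a *: f) <= `|a| * dual_norm f.
Proof.
apply: dual_norm_lub => [|x]; first by rewrite mulr_ge0.
by rewrite dualZE normrZ -mulrA ler_wpM2l.
Qed.

Let dual_normZ a (f : dual) : dual_norm (a *: f) = `|a| * dual_norm f.
Proof.
apply/eqP; rewrite eq_le dual_normZ_le/=.
have [->|a0] := eqVneq a 0; first by rewrite normr0 mul0r.
rewrite -[in leLHS](scalerK a0 f) mulrC -ler_pdivlMr ?normr_gt0// mulrC -normfV.
exact: dual_normZ_le.
Qed.

Let dual_norm_eq0 (f : dual) : dual_norm f = 0 -> f = 0.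
Proof.
move=> f0; apply: dualP => x; apply/eqP.
by rewrite -normr_le0 (le_trans (dual_norm_le f x))// f0 mul0r.
Qed.

HB.instance Definition _ :=
  Lmodule_isNormed.Build K dual dual_normD dual_normZ dual_norm_eq0.

Lemma dual_normE (f : dual) :
  `|f| = supremum 0 [set `|f x| | x in [set x : V | `|x| <= 1]].
Proof. by []. Qed.

Lemma dual_norm_bound (f : dual) x : `|f x| <= `|f| * `|x|.
Proof. exact: dual_norm_le. Qed.

Lemma dual_norm_least (f : dual) (M : K) : 0 <= M ->
  (forall x, `|f x| <= M * `|x|) -> `|f| <= M.
Proof. exact: dual_norm_lub. Qed.

End dual.

Section maps.
Variables (R : realType) (k : scalar_kind).
Local Notation K := (scalars R k).

Definition mkdual (V : normedModType K) (f : V -> K^o) (lf : linear f)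
    (bf : bounded_map (f : V -> K^o)) : dual V :=
  Dual (asboolT (conj lf bf)).

Definition canon_fun (V : normedModType K) (x : V) : dual V -> K^o :=
  fun f => f x.

Lemma canon_linear (V : normedModType K) (x : V) : linear (canon_fun x).
Proof. by []. Qed.

Lemma canon_bounded (V : normedModType K) (x : V) :
  bounded_map (canon_fun x : dual V -> K^o).
Proof. by exists `|x| => f; rewrite mulrC dual_norm_bound. Qed.

Definition bidual_embed (V : normedModType K) (x : V) : dual (dual V) :=
  mkdual (canon_linear x) (canon_bounded x).

Lemma bidual_embedE (V : normedModType K) (x : V) (f : dual V) :
  bidual_embed x f = f x.
Proof. by []. Qed.

Record bounded_linear (V W : normedModType K) := BoundedLinear {
  bl_fun :> {linear V -> W} ;
  bl_bounded : bounded_map bl_fun }.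

Section adjoint_map.
Variables (V W : normedModType K) (f : bounded_linear V W).

Definition transpose_val (w' : dual W) : V -> K^o := fun x => w' (f x).

Lemma transpose_val_linear w' : linear (transpose_val w').
Proof. by move=> a x y; rewrite /transpose_val !linearP. Qed.

Lemma transpose_val_bounded w' : bounded_map (transpose_val w' : V -> K^o).
Proof.
have [M fM] := bl_bounded f; exists (`|w'| * M) => x.
by rewrite (le_trans (dual_norm_bound w' _))// -mulrA ler_wpM2l.
Qed.

Definition transpose_fun (w' : dual W) : dual V :=
  mkdual (transpose_val_linear w') (transpose_val_bounded w').

Lemma transpose_linear : linear transpose_fun.
Proof. by move=> a u v; apply: dualP. Qed.

Lemma transpose_bounded : bounded_map transpose_fun.
Proof.
have [M M0 fM] := bounded_map_ge0 (bl_bounded f); exists M => w'.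
apply: dual_norm_least => [|x]; first by rewrite mulr_ge0.
rewrite (le_trans (dual_norm_bound w' (f x)))//.
by rewrite [M * _]mulrC -mulrA ler_wpM2l.
Qed.

HB.instance Definition _ :=
  GRing.isLinear.Build K (dual W) (dual V) *:%R transpose_fun transpose_linear.

Definition transpose : bounded_linear (dual W) (dual V) :=
  @BoundedLinear _ _ transpose_fun transpose_bounded.

Lemma transposeE w' x : transpose w' x = w' (f x).
Proof. by []. Qed.

End adjoint_map.

Record bounded_bilinear (X Y Z : normedModType K) := BoundedBilinear {
  bb_fun :> {bilinear X -> Y -> Z} ;
  bb_bounded : exists M : K, forall x y, `|bb_fun x y| <= M * `|x| * `|y| }.

Lemma bb_bounded_ge0 (X Y Z : normedModType K) (m : bounded_bilinear X Y Z) :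
  exists2 M : K, 0 <= M & forall x y, `|m x y| <= M * `|x| * `|y|.
Proof.
have [M mM] := bb_bounded m; exists `|M| => // x y.
apply: le_trans (mM x y) _.
have [->|x0] := eqVneq x 0; first by rewrite normr0 !(mulr0, mul0r).
have [->|y0] := eqVneq y 0; first by rewrite normr0 !mulr0.
have : 0 <= M * `|x| * `|y| by rewrite (le_trans _ (mM x y)).
by rewrite !pmulr_lge0 ?normr_gt0// => /ger0_norm ->.
Qed.

Section arens.
Variables (X Y Z : normedModType K) (m : bounded_bilinear X Y Z).

Definition flip_fun (y : Y) (x : X) : Z := m x y.

Lemma flip_bilinear : bilinear_for *:%R *:%R flip_fun.
Proof. by split=> [x|y] a u v; rewrite /flip_fun ?linearPr ?linearPl. Qed.

HB.instance Definition _ :=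
  bilinear_isBilinear.Build K Y X Z *:%R *:%R flip_fun flip_bilinear.

Lemma flip_bounded :
  exists M : K, forall y x, `|flip_fun y x| <= M * `|y| * `|x|.
Proof.
by have [M mM] := bb_bounded m; exists M => y x; rewrite mulrAC; exact: mM.
Qed.

Definition flip : bounded_bilinear Y X Z :=
  @BoundedBilinear _ _ _ flip_fun flip_bounded.

Lemma flipE y x : flip y x = m x y. Proof. by []. Qed.

Definition arens_val (z' : dual Z) (x : X) : Y -> K^o := fun y => z' (m x y).

Lemma arens_val_linear z' x : linear (arens_val z' x).
Proof. by move=> a u v; rewrite /arens_val linearPr linearP. Qed.

Lemma arens_val_bounded z' x : bounded_map (arens_val z' x : Y -> K^o).
Proof.
have [M mM] := bb_bounded m; exists (`|z'| * (M * `|x|)) => y.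
by rewrite (le_trans (dual_norm_bound z' _))// -mulrA ler_wpM2l.
Qed.

Definition arens_fun (z' : dual Z) (x : X) : dual Y :=
  mkdual (arens_val_linear z' x) (arens_val_bounded z' x).

Lemma arens_bilinear : bilinear_for *:%R *:%R arens_fun.
Proof.
split=> [x|z'] a u v; apply: dualP => y //=.
by rewrite /arens_fun /= /arens_val linearPl linearP.
Qed.

HB.instance Definition _ := bilinear_isBilinear.Build K (dual Z) X (dual Y)
  *:%R *:%R arens_fun arens_bilinear.

Lemma arens_bounded :
  exists M : K, forall z' x, `|arens_fun z' x| <= M * `|z'| * `|x|.
Proof.
have [M M0 mM] := bb_bounded_ge0 m; exists M => z' x.
apply: dual_norm_least => [|y]; first by rewrite !mulr_ge0.
rewrite (le_trans (dual_norm_bound z' (m x y)))//.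
by rewrite [M * _]mulrC -!mulrA ler_wpM2l// mulrA.
Qed.

(* The Arens adjoint of a bilinear map; [arens3] is its third iterate. *)
Definition arens : bounded_bilinear (dual Z) X (dual Y) :=
  @BoundedBilinear _ _ _ arens_fun arens_bounded.

Lemma arensE z' x y : arens z' x y = z' (m x y).
Proof. by []. Qed.

End arens.

Definition arens3 (X Y Z : normedModType K) (m : bounded_bilinear X Y Z) :
    bounded_bilinear (dual (dual X)) (dual (dual Y)) (dual (dual Z)) :=
  arens (arens (arens m)).

(* Not assumed to have a unit. *)
Record banach_algebra := BanachAlgebra {
  ba_space :> completeNormedModType K ;
  ba_mul : bounded_bilinear ba_space ba_space ba_space ;
  ba_mulA : forall x y z, ba_mul x (ba_mul y z) = ba_mul (ba_mul x y) z ;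
  ba_normM : forall x y, `|ba_mul x y| <= `|x| * `|y| }.

Record banach_bimodule (A : banach_algebra) := BanachBimodule {
  bm_space :> completeNormedModType K ;
  lact : bounded_bilinear A bm_space bm_space ;
  ract : bounded_bilinear bm_space A bm_space ;
  lactA : forall x y b, lact x (lact y b) = lact (ba_mul A x y) b ;
  ractA : forall b x y, ract (ract b x) y = ract b (ba_mul A x y) ;
  lractA : forall x b y, lact x (ract b y) = ract (lact x b) y }.

Section bimodule.
Variables (A : banach_algebra) (B : banach_bimodule A).

Definition dual_lact : bounded_bilinear A (dual B) (dual B) :=
  flip (arens (flip (ract B))).
Definition dual_ract : bounded_bilinear (dual B) A (dual B) := arens (lact B).

Lemma dual_lactE a (b' : dual B) b : dual_lact a b' b = b' (ract B b a).
Proof. by []. Qed.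

Lemma dual_ractE (b' : dual B) a b : dual_ract b' a b = b' (lact B a b).
Proof. by []. Qed.

Definition derivation (D : bounded_linear A (dual B)) :=
  forall x y, D (ba_mul A x y) = dual_lact x (D y) + dual_ract (D x) y.

(* The right action of A^** on B^**. *)
Definition ract2 :
    bounded_bilinear (dual (dual B)) (dual (dual A)) (dual (dual B)) :=
  arens3 (ract B).

Definition triple_mul : bounded_bilinear
    (dual (dual (dual B))) (dual (dual B)) (dual (dual (dual A))) :=
  arens ract2.

Lemma triple_mulE (b''' : dual (dual (dual B))) (b'' : dual (dual B))
    (a'' : dual (dual A)) :
  triple_mul b''' b'' a'' = b''' (ract2 b'' a'').
Proof. by []. Qed.

End bimodule.

(* sigma(V', V) on the dual V' of V: topology of pointwise convergence. *)
Definition weak_star (V : normedModType K) : topologicalType :=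
  initial_topology (@dual_fun R k V : dual V -> {ptws V -> K}).

(* sigma(V, V'): initial topology for all functionals in the dual V' of V. *)
Definition weak (V : normedModType K) : topologicalType :=
  initial_topology ((fun v f => f v) : V -> {ptws dual V -> K}).

Definition Ztilde_l (A : banach_algebra) (B : banach_bimodule A) :
    set (dual (dual B)) :=
  [set b'' |
    continuous (ract2 B b'' : weak_star (dual A) -> weak (dual (dual B)))].

End maps.

Arguments dual_lact {R k A} B.
Arguments dual_ract {R k A} B.
Arguments ract2 {R k A} B.
Arguments triple_mul {R k A} B.
Arguments Ztilde_l {R k A} B.

(* Main.v *)
Require Import Defs.
From mathcomp Require Import all_boot all_order all_algebra.
From mathcomp Require Import all_classical all_reals.
From mathcomp Require Import topology normedtype.

Import Order.TTheory GRing.Theory Num.Theory.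
Import numFieldNormedType.Exports.

Local Open Scope classical_set_scope.
Local Open Scope ring_scope.

(** For [b'''] in [B^***] and [b''] in [B^**], the functional [b''' b''] on
    [A^**] is the composite of [a'' |-> b'' a''] with [b''']. When [b''] belongs
    to [Ztilde_l B], the first map is continuous from the weak* to the weak
    topology, and [b'''] is weakly continuous ([weak_dual_continuous]); hence
    [b''' b''] is weak*-continuous on [A^**].

    It remains to see that the weak*-continuous functionals on a dual space
    [V^*] are the evaluations at points of [V] ([weak_star_continuous_embed]).
    Weak*-continuity at 0 bounds such a functional [F] on the annihilator of a
    finite subset of [V]; as this annihilator is a subspace, [F] vanishes on
    it ([weak_star_continuous_finite_kernel]). A functional that vanishes on the
    common kernel of finitely many evaluations is a linear combination of them,
    hence an evaluation itself ([finite_kernel_embed]). *)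

Lemma initial_cvg (S : choiceType) (T : topologicalType) (f : S -> T)
    (F : set_system S) (s : S) : Filter F ->
  f @ F --> f s -> F --> (s : initial_topology f).
Proof.
move=> FF fF A /= [_ [[B oB <-] Bs] sBA].
by apply: filterS sBA _; apply: fF; exact: open_nbhs_nbhs.
Qed.

Section weak_star_dual.
Variables (R : realType) (k : scalar_kind).
Local Notation K := (scalars R k).

Definition annihilator {V : normedModType K} (s : seq V) : set (dual V) :=
  [set f | forall v, v \in s -> f v = 0].

(** The filter of the neighbourhoods of 0 for the linear topology in which the
    annihilators of finite sets form a base. That topology refines the weak*
    one, so weak*-continuity at 0 can be tested on annihilators, which have
    the advantage of being subspaces. *)
Definition annihilator_filter (V : normedModType K) : set_system (dual V) :=
  [set U | exists s : seq V, annihilator s `<=` U].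

#[local] Instance annihilator_filter_filter (V : normedModType K) :
  Filter (annihilator_filter V).
Proof.
split=> [|P Q [s sP] [t tQ]|P Q PQ [s sP]].
- by exists [::].
- by exists (s ++ t) => f fst; split; [apply: sP|apply: tQ] => v vs;
    apply: fst; rewrite mem_cat vs ?orbT.
- by exists s; apply: subset_trans PQ.
Qed.

Lemma annihilator_filter_cvg0 (V : normedModType K) :
  annihilator_filter V --> (0 : weak_star V).
Proof.
apply: initial_cvg; apply/pointwise_cvgP => v A /nbhs_singleton A0.
exists [:: v] => f /(_ v); rewrite mem_head => /(_ isT) fv.
by rewrite /= fv.
Qed.

(** On some annihilator [F] takes only values of modulus less than 1. If [F f]
    were nonzero for an [f] in it, the annihilator would also contain
    [(F f)^-1 *: f], where [F] equals 1. *)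
Lemma weak_star_continuous_finite_kernel (V : normedModType K)
    (F : dual (dual V)) :
  continuous (F : weak_star V -> K) ->
  exists s : seq V, forall f, annihilator s f -> F f = 0.
Proof.
move=> /(_ 0) cF.
have [s sF] : annihilator_filter V [set f | `|F f| < 1].
  apply: annihilator_filter_cvg0.
  have F0 : dual_fun F 0 = 0 :> K by exact: linear0.
  have : nbhs (F 0 : K) [set c : K | `|c| < 1].
    by rewrite F0; exists 1 => //= c; rewrite /ball_ /= sub0r normrN.
  by move=> /cF.
exists s => f fs; apply: contrapT => /eqP Ff0.
have /sF : annihilator s ((F f)^-1 *: f).
  by move=> v vs; rewrite dualZE fs// scaler0.
by rewrite /= linearZ /= /GRing.scale /= mulVf// normr1 ltxx.
Qed.

(** Induction on [s]: if some [f0] in the annihilator of [s] does not vanish at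
    [v], then subtracting from [F] the multiple of the evaluation at [v] that
    agrees with [F] at [f0] gives a functional vanishing on the annihilator of
    [s]. *)
Lemma finite_kernel_embed (V : normedModType K) (s : seq V)
    (F : dual (dual V)) :
  (forall f, annihilator s f -> F f = 0) -> range (@bidual_embed R k V) F.
Proof.
elim: s F => [|v s IHs] F sF.
  by exists 0 => //; apply: dualP => f; rewrite bidual_embedE linear0 sF.
have [sv|] := pselect (forall f, annihilator s f -> f v = 0).
  apply: IHs => f fs; apply: sF => w; rewrite inE => /predU1P[->|].
    exact: sv.
  exact: fs.
move=> /existsNP[f0 /not_implyP[f0s /eqP f0v]].
have [] := IHs (F - (F f0 / f0 v) *: bidual_embed v).
  move=> f fs.
  (* Project [f] along [f0] onto the functionals that also vanish at [v]. *)
  have /sF : annihilator (v :: s) (f - (f v / f0 v) *: f0).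
    move=> w; rewrite inE dualDE -scaleNr dualZE => /predU1P[->|ws].
      by rewrite /GRing.scale /= mulNr divfK// subrr.
    by rewrite fs// (f0s w ws) /GRing.scale /= mulr0 addr0.
  rewrite dualDE -[- (_ *: bidual_embed _)]scaleNr dualZE bidual_embedE.
  rewrite linearB linearZ /=.
  move=> /eqP; rewrite subr_eq0 => /eqP ->.
  by rewrite /GRing.scale /= mulNr mulrAC (mulrAC (F f0)) (mulrC (f v)) subrr.
move=> u _ uF; exists (u + (F f0 / f0 v) *: v) => //.
apply: dualP => f; rewrite bidual_embedE linearD linearZ /=.
have := congr1 (fun G : dual (dual V) => G f) uF.
rewrite bidual_embedE dualDE -scaleNr dualZE bidual_embedE => ->.
by rewrite scaleNr subrK.
Qed.

Lemma weak_star_continuous_embed (V : normedModType K) (F : dual (dual V)) :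
  continuous (F : weak_star V -> K) -> range (@bidual_embed R k V) F.
Proof.
by move=> /weak_star_continuous_finite_kernel[s]; exact: finite_kernel_embed.
Qed.

Lemma weak_dual_continuous (V : normedModType K) (f : dual V) :
  continuous (f : weak V -> K).
Proof.
move=> v.
set ev := fun (u : V) (g : dual V) => g u : K.
have cev : ev @ (v : weak V) --> (ev v : {ptws dual V -> K}).
  exact: (@initial_continuous V {ptws dual V -> K} ev v).
have FF : Filter (ev @ (v : weak V)) :=
  fmap_filter ev (nbhs_filter (v : weak V)).
exact: (proj1 (pointwise_cvgP (ev v) FF) cev f).
Qed.

End weak_star_dual.

Theorem mainTheorem8 (R : realType) (k : scalar_kind)
    (A : banach_algebra R k) (B : banach_bimodule A)
    (D : bounded_linear A (dual B)) :
  Ztilde_l B = setT ->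
  derivation D ->
  [set triple_mul B b''' b'' |
     b''' in range (transpose (transpose D)) & b'' in [set: dual (dual B)]]
    `<=` range (@bidual_embed R k (dual A)).
Proof.
move=> ZB _ _ [b''' _ [b'' _ <-]]; apply: weak_star_continuous_embed => a''.
have Zb : Ztilde_l B b'' by rewrite ZB.
apply: (@continuous_comp (weak_star (dual A)) (weak (dual (dual B)))
  (scalars R k) (ract2 B b'') b'''); first exact: Zb.
exact: weak_dual_continuous.
Qed.
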